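(* The nanostar dendrimer graph $D_2$ is a $G_\phi$-graph, where $D_2$ is the tree on $16$ vertices consisting of a central vertex $c$ of degree $3$, three internally disjoint paths of length $3$ starting at $c$ and ending at vertices $e_1,e_2,e_3$, and two pendant leaves attached to each of $e_1,e_2,e_3$.
   Context: $\phi$ denotes Euler's totient function, $\phi^0(n)=n$ and $\phi^i(n)=\phi(\phi^{i-1}(n))$. For a set $A$ of positive integers, $A_\phi=\{\phi^k(n): n\in A,\ k\ge 0\}$, and $G_\phi(A)$ is the simple graph with vertex set $A_\phi$ in which distinct vertices $r,s$ are adjacent iff $\phi(r)=s$ or $\phi(s)=r$. A graph $H$ is a $G_\phi$-graph if $H$ is isomorphic to $G_\phi(A)$ for some set $A$ of positive integers. *)

(* Defs.v *)
From mathcomp Require Import all_boot.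
From mathcomp Require Import boolp classical_sets.

Set Implicit Arguments.
Unset Strict Implicit.
Unset Printing Implicit Defensive.

Local Open Scope classical_set_scope.

(* Simple graphs, possibly infinite: no finiteness of the vertex type is
   assumed because G_phi(A) is defined for arbitrary sets A. *)
Record sgraph := SGraph {
  vertex :> Type;
  adj : vertex -> vertex -> Prop;
  adj_sym : forall u v, adj u v -> adj v u;
  adj_irrefl : forall u, ~ adj u u
}.

Definition isomorphic (G H : sgraph) : Prop :=
  exists f : G -> H,
    bijective f /\ forall u v : G, adj u v <-> adj (f u) (f v).

Definition phi_closure (A : set nat) : set nat :=
  [set m | exists n k, A n /\ m = iter k totient n].

(* The vertex type is [phi_closure A] coerced to a subtype of [nat].  The
   condition [r <> s] discards the loop at 1 coming from totient 1 = 1. *)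
Definition Gphi_adj (A : set nat) (r s : phi_closure A) : Prop :=
  r <> s /\ (totient (val r) = val s \/ totient (val s) = val r).

Lemma Gphi_adj_sym (A : set nat) (r s : phi_closure A) :
  Gphi_adj r s -> Gphi_adj s r.
Proof. by case=> rs [h|h]; split; [exact: nesym | right | exact: nesym | left]. Qed.

Lemma Gphi_adj_irrefl (A : set nat) (r : phi_closure A) : ~ Gphi_adj r r.
Proof. by case. Qed.

Definition Gphi (A : set nat) : sgraph :=
  SGraph (@Gphi_adj_sym A) (@Gphi_adj_irrefl A).

Definition is_Gphi_graph (H : sgraph) : Prop :=
  exists A : set nat, A `<=` [set n | 0 < n] /\ isomorphic H (Gphi A).

(* [D2_path b i] is the vertex at distance i + 1 from the centre on branch b;
   thus e_b is [D2_path b 2].  [D2_leaf b j] is a leaf attached to e_b. *)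
Inductive D2_vertex : Type :=
| D2_center
| D2_path of 'I_3 & 'I_3
| D2_leaf of 'I_3 & 'I_2.

(* Each edge once, oriented away from the centre. *)
Definition D2_arc (u v : D2_vertex) : Prop :=
  match u, v with
  | D2_center, D2_path _ i => i = 0 :> nat
  | D2_path b i, D2_path b' i' => b = b' /\ i' = i.+1 :> nat
  | D2_path b i, D2_leaf b' _ => b = b' /\ i = 2 :> nat
  | _, _ => False
  end.

Definition D2_adj (u v : D2_vertex) : Prop := D2_arc u v \/ D2_arc v u.

Lemma D2_adj_sym (u v : D2_vertex) : D2_adj u v -> D2_adj v u.
Proof. by case; [right | left]. Qed.

Lemma D2_adj_irrefl (u : D2_vertex) : ~ D2_adj u u.
Proof. by case: u => [|b i|b j] [] //= [_] /n_Sn. Qed.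

Definition nanostar_D2 : sgraph := SGraph D2_adj_sym D2_adj_irrefl.

(* Main.v *)
(* Since phi(1) = 1 and 2 is the only other n with phi(n) = 1, the vertex 1 has
   to be a leaf of D_2 and 2 the branch point e_1 next to it.  Rooting D_2 at
   this leaf turns phi into the parent map, and it remains to label the tree:
     1, 3 - 2 - 4 - 8 - 16,
     16 - 32 - 64 - 128 - 255, 256,
     16 - 40 - 100 - 250 - 251, 502. *)
From mathcomp Require Import all_boot.
From mathcomp Require Import boolp classical_sets.
Require Import Defs.

Set Implicit Arguments.
Unset Strict Implicit.
Unset Printing Implicit Defensive.

Local Open Scope classical_set_scope.

Definition D2_label (v : D2_vertex) : nat :=
  match v with
  | D2_center => 16
  | D2_path b i =>
      nth 0 (nth [::] [:: [:: 8; 4; 2]; [:: 32; 64; 128]; [:: 40; 100; 250]] b) i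
  | D2_leaf b j =>
      nth 0 (nth [::] [:: [:: 1; 3]; [:: 255; 256]; [:: 251; 502]] b) j
  end.

(* The root [D2_leaf ord0 ord0] is its own parent, as totient 1 = 1. *)
Definition D2_parent (v : D2_vertex) : D2_vertex :=
  match v with
  | D2_center => D2_path ord0 ord0
  | D2_path b i =>
      if b == 0 :> nat then
        if i == 2 :> nat then D2_leaf ord0 ord0 else D2_path b (inord i.+1)
      else if i == 0 :> nat then D2_center else D2_path b (inord i.-1)
  | D2_leaf b j =>
      if (b == 0 :> nat) && (j == 0 :> nat) then v else D2_path b ord_max
  end.

(** The totient halves powers of two above 1; otherwise 255 = 3 * 5 * 17 gives 2 * 4 * 16 = 128, 251
    is prime, and the rest are equally small computations. *)
Lemma totient_D2_label v : totient (D2_label v) = D2_label (D2_parent v).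
Proof.
by case: v => [|[[|[|[|b]]] hb] [[|[|[|i]]] hi]|[[|[|[|b]]] hb] [[|[|j]] hj]] //;
  rewrite /D2_label /D2_parent /= ?inordK //; vm_compute.
Qed.

Lemma D2_label_gt0 v : 0 < D2_label v.
Proof.
by case: v => [|[[|[|[|b]]] hb] [[|[|[|i]]] hi]|[[|[|[|b]]] hb] [[|[|j]] hj]].
Qed.

Lemma D2_label_inj : injective D2_label.
Proof.
case=> [|[[|[|[|b]]] hb] [[|[|[|i]]] hi]|[[|[|[|b]]] hb] [[|[|j]] hj]] //;
(* Off the diagonal the numerals differ; on it the two vertices differ at most in the bound proofs
   of their ordinals. *)
case=> [|[[|[|[|b']]] hb'] [[|[|[|i']]] hi']|[[|[|[|b']]] hb'] [[|[|j']] hj']] //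
  => _; by [congr D2_path; apply: val_inj | congr D2_leaf; apply: val_inj].
Qed.

Lemma D2_adj_parent u v :
  D2_adj u v <-> u <> v /\ (D2_parent u = v \/ D2_parent v = u).
Proof.
(* Arcs leave the centre while parents lead to the root: the two directions agree, giving the left
   disjunct, only on the path from the centre to [D2_leaf ord0 ord0]. *)
have arc_parent x y : D2_arc x y -> D2_parent x = y \/ D2_parent y = x.
  case: x y => [|b i|b j] [|b' i'|b' j'] //=.
  - move=> i'0; case: eqP => b'0; last by right; rewrite i'0.
    by left; congr D2_path; apply: val_inj; rewrite /= ?b'0 ?i'0.
  - case=> <- i'E; case: eqP => b0.
      left; case: eqP => [i2|_]; first by have := ltn_ord i'; rewrite i'E i2.
      by congr D2_path; apply: val_inj; rewrite /= inordK -i'E.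
    by right; rewrite i'E /=; congr D2_path; apply: val_inj; rewrite /= inordK.
  - case=> <- i2; case: eqP => b0 /=; last first.
      by right; congr D2_path; apply: val_inj.
    rewrite i2 /=; case: eqP => j0; [left | right].
      by congr D2_leaf; apply: val_inj.
    by congr D2_path; apply: val_inj.
(* The premise excludes just the root, the one fixed point of [D2_parent]. *)
have parent_adj x : D2_parent x <> x -> D2_adj x (D2_parent x).
  case: x => [|b i|b j] /=.
  - by left.
  - case: eqP => b0; case: eqP => i0 _.
    + by left; split=> //; apply: val_inj.
    + left; split=> //=; rewrite inordK //.
      by case: i i0 => [[|[|[|i]]] hi].
    + by right.
    + right; split=> //=; rewrite inordK.
        by case: (i : nat) i0.
      exact: leq_ltn_trans (leq_pred _) (ltn_ord i).
  - by case: ifP => // _ _; right.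
split=> [uv|[uv [uE|vE]]].
- split; first by move=> uE; move: uv; rewrite uE; exact: D2_adj_irrefl.
  by case: uv => /arc_parent // [|]; [right | left].
- by rewrite -uE; apply: parent_adj; rewrite uE; exact: nesym.
- by apply: D2_adj_sym; rewrite -vE; apply: parent_adj; rewrite vE.
Qed.

(** Since [D2_label] carries [D2_parent] to [totient], k totient steps from a label end at the label
    of the k-th ancestor. *)
Lemma phi_closure_D2_label : phi_closure (range D2_label) = range D2_label.
Proof.
apply/seteqP; split=> [_ [_ [k [[v _ <-] ->]]]|_ [v _ <-]].
  exists (iter k D2_parent v) => //.
  by elim: k => //= k <-; rewrite totient_D2_label.
by exists (D2_label v), 0; split=> //; exists v.
Qed.

Theorem theorem3p4 : is_Gphi_graph nanostar_D2.
Proof.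
exists (range D2_label); split=> [_ [v _ <-]|]; first exact: D2_label_gt0.
have labelP v : D2_label v \in phi_closure (range D2_label).
  by rewrite phi_closure_D2_label; apply/mem_set; exists v.
pose f v : Gphi (range D2_label) := exist _ (D2_label v) (labelP v).
have f_inj : injective f by move=> u v /(congr1 val)/D2_label_inj.
(* Surjectivity of [f] yields a right inverse [g], which injectivity makes two-sided. *)
have /choice[g fK] : forall y, exists v, f v = y.
  case=> m m_cl; have: range D2_label m.
    by rewrite -phi_closure_D2_label; exact: set_mem.
  by case=> v _ vm; exists v; apply: val_inj.
exists f; split; first by exists g => // v; apply: f_inj.
move=> u v; apply: (iff_trans (D2_adj_parent u v)).
(* Totients of labels become labels of parents, so injectivity reduces both sides to the same parent
   relation. *)
rewrite /= /Gphi_adj /= !totient_D2_label.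
split=> -[uv puv]; split.
- by move/f_inj.
- by case: puv => ->; [left | right].
- by move=> uE; apply: uv; rewrite uE.
- by case: puv => /D2_label_inj; [left | right].
Qed.
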